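(* Let $\beta>0$, $M>0$, and consider the Hölder density class $$\mathcal{H}_{den}(\beta,M)=\left\{f=\sum_{l\ge0,\,0\le k\le 2^l-1}f_{lk}\psi_{lk}:\ f\ge0,\ \int_0^1 f=1,\ \sup_{l\ge0,\,0\le k\le 2^l-1}2^{l(1/2+\beta)}|f_{lk}|\le M\right\}.$$ For $\epsilon\in[0,1]$, let $X_1,\dots,X_n$ be i.i.d. from $(1-\epsilon)P_f+\epsilon Q$, and let $\hat f$ be the pairwise-tournament estimator (defined in the context) over $\mathcal{H}_{den}(\beta,M)$ with $\delta\asymp n^{-\beta/(2\beta+1)}$. Then there are constants $C,C'>0$ such that $$\|\hat f-f\|_1^2\le C\left(n^{-\frac{2\beta}{2\beta+1}}\vee\epsilon^2\right)$$ with $\mathbb{P}_{(\epsilon,f,Q)}$-probability at least $1-\exp\left(-C'\left(n^{\frac{1}{2\beta+1}}+n\epsilon^2\right)\right)$, uniformly over all probability distributions $Q$ and all $f\in\mathcal{H}_{den}(\beta,M)$.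
   Context: $P_f$ is the probability distribution on $[0,1]$ with density $f$ with respect to Lebesgue measure; $\{\psi_{lk}\}_{l\ge0,0\le k\le2^l-1}$ is an orthonormal wavelet basis of $L^2[0,1]$ (the Cohen–Daubechies–Vial construction of wavelets on the interval). $\mathbb{P}_{(\epsilon,f,Q)}$ is the law under which the data are i.i.d. from $(1-\epsilon)P_f+\epsilon Q$. $a\vee b=\max(a,b)$; $\|\cdot\|_1$ is the $L^1[0,1]$ norm; $\mathsf{TV}$ is total variation distance. $\delta\asymp r_n$ means $c_1r_n\le\delta\le c_2r_n$ for fixed constants $0<c_1\le c_2$. The constants $C,C'$ do not depend on $n,\epsilon,f,Q$ (they may depend on $\beta$, $M$, the basis, $c_1,c_2$). Tournament estimator over a class $\mathcal{F}$ of densities at scale $\delta$: let $\{f_1,\dots,f_m\}\subset\mathcal{F}$ be a $\delta$-covering set of minimal cardinality, i.e. $m$ is the smallest number such that for every $f\in\mathcal{F}$ there is $j$ with $\mathsf{TV}(P_{f_j},P_f)\le\delta$. For $j\ne k$ put $A_{jk}=\{x:f_j(x)>f_k(x)\}$, $P_n(A)=\frac1n\sum_{i=1}^n\mathbb{I}\{X_i\in A\}$ and $\phi_{jk}=\mathbb{I}\{|P_n(A_{jk})-P_{f_j}(A_{jk})|>|P_n(A_{jk})-P_{f_k}(A_{jk})|\}$. Then $\hat f=f_{\hat j}$ with $\hat j\in\arg\min_j\sum_{k\ne j}\phi_{jk}$ (any minimizer). *)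

(* Defs.v *)
From HB Require Import structures.
From mathcomp Require Import all_boot all_order all_algebra.
From mathcomp Require Import all_classical all_reals all_analysis.

Set Implicit Arguments.
Unset Strict Implicit.
Unset Printing Implicit Defensive.

Import Order.TTheory GRing.Theory Num.Theory.
Import numFieldNormedType.Exports.

Local Open Scope classical_set_scope.
Local Open Scope ring_scope.

Definition inner (R : realType) (D : set R) (f g : R -> R) : R :=
  \int[@lebesgue_measure R]_(x in D) (f x * g x).

Definition square_integrable (R : realType) (D : set R) (f : R -> R) : Prop :=
  measurable_fun D f /\
  (\int[@lebesgue_measure R]_(x in D) ((f x) ^+ 2)%:E < +oo)%E.

Definition wavelet_partial_sum (R : realType) (psi : nat -> nat -> R -> R)
    (c : nat -> nat -> R) (L : nat) (x : R) : R :=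
  \sum_(0 <= l < L) \sum_(0 <= k < 2 ^ l) c l k * psi l k x.

(* [f = \sum_{l,k} c_{lk} psi_{lk}], the series converging in L^2[0,1]. *)
Definition L2_expansion (R : realType) (psi : nat -> nat -> R -> R)
    (c : nat -> nat -> R) (f : R -> R) : Prop :=
  (fun L : nat => \int[@lebesgue_measure R]_(x in `[0%R, 1%R])
     ((f x - wavelet_partial_sum psi c L x) ^+ 2)%:E)%E @ \oo --> 0%E.

Definition orthonormal_basis01 (R : realType) (psi : nat -> nat -> R -> R)
    : Prop :=
  [/\ forall l k, (k < 2 ^ l)%N -> square_integrable `[0, 1] (psi l k),
      forall l k l' k', (k < 2 ^ l)%N -> (k' < 2 ^ l')%N ->
        inner `[0, 1] (psi l k) (psi l' k') = ((l, k) == (l', k'))%:R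
    & forall g, square_integrable `[0, 1] g ->
        L2_expansion psi (fun l k => inner `[0, 1] g (psi l k)) g].

(* Daubechies scaling function [phi] and wavelet [psi] with [N] vanishing
   moments, both supported in [-N+1, N].  The filter is
   h_{-N+1}, ..., h_N, stored as [h i] = h_{i-N+1} for i < 2N, and
     phi(x) = sqrt 2 \sum_k h_k phi(2x - k),
     psi(x) = sqrt 2 \sum_k (-1)^k h_{1-k} phi(2x - k). *)
Definition daubechies_pair (R : realType) (N : nat) (phi psi : R -> R) : Prop :=
  [/\ measurable_fun setT phi,
      forall x, ~~ (1 - N%:R <= x <= N%:R) -> phi x = 0,
      \int[@lebesgue_measure R]_(x in setT) phi x = 1,
      forall m : int, inner setT phi (fun x => phi (x - m%:~R)) = (m == 0)%:R
    & exists h : nat -> R,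
        [/\ forall x, phi x = Num.sqrt 2 *
              \sum_(0 <= i < 2 * N) h i * phi (2 * x - (i%:R - N%:R + 1)),
            forall x, psi x = Num.sqrt 2 *
              \sum_(0 <= i < 2 * N) (-1) ^+ (i + N + 1) *
                h (2 * N - 1 - i)%N * phi (2 * x - (i%:R - N%:R + 1))
          & forall p, (p < N)%N ->
              \int[@lebesgue_measure R]_(x in setT) (x ^+ p * psi x) = 0]].

(* Before orthonormalization, the k-th edge function at 0 of the half-line
   [0, +oo[ is the restriction of \sum_{n=k}^{2N-2} C(n,k) phi(x + n - N + 1);
   its support is [0, 2N-1-k]. *)
Definition raw_edge (R : realType) (N : nat) (phi : R -> R) (k : nat) (x : R)
    : R :=
  if 0 <= x then
    \sum_(k <= n < (2 * N).-1) 'C(n, k)%:R * phi (x + n%:R - N%:R + 1)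
  else 0.

(* The N edge scaling functions [phiE k] at 0 result from the Gram-Schmidt
   procedure run on [raw_edge] from k = N-1 down to k = 0.  The N edge wavelets
   [psiE k] form an orthonormal family in V_1 minus V_0, orthogonal to the
   interior wavelets, and with staggered supports [0, N+k].  Here V_0 is
   generated by the [phiE j] and the interior translates phi(x - m), m >= N,
   and V_1 by their dilates. *)
Definition edge_functions (R : realType) (N : nat) (phi psi : R -> R)
    (phiE psiE : nat -> R -> R) : Prop :=
  let H : set R := `[0, +oo[%classic in
  [/\ forall k, (k < N)%N -> exists a : nat -> R, forall x,
        phiE k x = \sum_(k <= j < N) a j * raw_edge N phi j x,
      forall k k', (k < N)%N -> (k' < N)%N ->
        inner H (phiE k) (phiE k') = (k == k')%:R,
      forall k, (k < N)%N -> exists (b c : nat -> R), forall x,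
        psiE k x = \sum_(0 <= j < N) b j * phiE j (2 * x)
          + \sum_(N <= m < (N + 2 * k).+1) c m * phi (2 * x - m%:R),
      forall k k', (k < N)%N -> (k' < N)%N ->
        inner H (psiE k) (psiE k') = (k == k')%:R
    & forall k, (k < N)%N ->
        (forall j, (j < N)%N -> inner H (psiE k) (phiE j) = 0) /\
        (forall m, (N <= m)%N ->
          inner H (psiE k) (fun x => phi (x - m%:R)) = 0 /\
          inner H (psiE k) (fun x => psi (x - m%:R)) = 0)].

(* Level-j functions on [0,1], k < 2^j, from a mother function [f] and edge
   functions [fL] at 0 and [fR] at 1; the latter are functions of the distance
   to the endpoint 1. *)
Definition interval_function (R : realType) (N : nat) (f : R -> R)
    (fL fR : nat -> R -> R) (j k : nat) (x : R) : R :=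
  Num.sqrt (2 ^+ j) *
  (if (k < N)%N then fL k (2 ^+ j * x)
   else if (k < 2 ^ j - N)%N then f (2 ^+ j * x - k%:R)
   else fR (2 ^ j - 1 - k)%N (2 ^+ j * (1 - x))).

(* The CDV system of coarsest level J consists of the 2^J scaling functions of
   level J, indexed here by (J-1, k), and of the 2^j wavelets (j, k) of each
   level j >= J. *)
Definition cdv_index (J : nat) (p : nat * nat) : Prop :=
  if (p.1 < J)%N then p.1 = J.-1 /\ (p.2 < 2 ^ J)%N else (p.2 < 2 ^ p.1)%N.

(* Since 2^J + \sum_{J <= j < L} 2^j = 2^L while the pairs l < L, k < 2^l number
   2^L - 1, the CDV system cannot be labelled by such pairs level by level.  A
   labelling is therefore a bijection [tau] from these pairs onto the CDV system
   that displaces levels by a bounded amount. *)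
Definition cdv_basis (R : realType) (psi : nat -> nat -> R -> R) : Prop :=
  orthonormal_basis01 psi /\
  exists (N J : nat) (phi0 psi0 : R -> R) (phiL psiL phiR psiR : nat -> R -> R)
    (tau : nat -> nat -> nat * nat) (D : nat),
  [/\ (0 < N)%N /\ (2 * N <= 2 ^ J)%N,
      daubechies_pair N phi0 psi0,
      edge_functions N phi0 psi0 phiL psiL /\
      edge_functions N (fun x => phi0 (1 - x)) (fun x => psi0 (1 - x))
        phiR psiR,
      [/\ forall l k, (k < 2 ^ l)%N ->
            [/\ cdv_index J (tau l k), ((tau l k).1 <= l + D)%N
              & (l <= (tau l k).1 + D)%N],
          forall l k l' k', (k < 2 ^ l)%N -> (k' < 2 ^ l')%N ->
            tau l k = tau l' k' -> (l, k) = (l', k')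
        & forall p, cdv_index J p ->
            exists l k, (k < 2 ^ l)%N /\ tau l k = p]
    & forall l k x, (k < 2 ^ l)%N -> 0 <= x <= 1 ->
        psi l k x =
          if ((tau l k).1 < J)%N
          then interval_function N phi0 phiL phiR J (tau l k).2 x
          else interval_function N psi0 psiL psiR (tau l k).1 (tau l k).2 x].

(* Only the values on [0,1] of a density [f : R -> R] matter. *)
Definition holder_density (R : realType) (psi : nat -> nat -> R -> R)
    (beta M : R) : set (R -> R) :=
  [set f : R -> R | [/\ measurable_fun (`[0, 1] : set R) f,
      forall x, 0 <= x <= 1 -> 0 <= f x,
      (\int[@lebesgue_measure R]_(x in `[0%R, 1%R]) (f x)%:E = 1)%E
    & exists c : nat -> nat -> R, L2_expansion psi c f /\
        forall l k, (k < 2 ^ l)%N ->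
          2 `^ (l%:R * (2^-1 + beta)) * `|c l k| <= M]].

Definition density_prob (R : realType) (f : R -> R) (A : set R) : \bar R :=
  (\int[@lebesgue_measure R]_(x in `[0%R, 1%R] `&` A) (f x)%:E)%E.

Definition TV (R : realType) (mu nu : set R -> \bar R) : \bar R :=
  ereal_sup [set `|mu A - nu A|%E | A in [set A : set R | measurable A]].

Definition L1_dist (R : realType) (f g : R -> R) : \bar R :=
  (\int[@lebesgue_measure R]_(x in `[0%R, 1%R]) (`|f x - g x|%R)%:E)%E.

Definition contaminated (R : realType) (eps : R) (f : R -> R)
    (Q : set R -> \bar R) (A : set R) : \bar R :=
  ((1 - eps)%:E * density_prob f A + eps%:E * Q A)%E.

Definition iid_sample (R : realType) (d : measure_display)
    (T : measurableType d) (P : probability T R) (n : nat)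
    (X : 'I_n -> {RV P >-> R}) (law : set R -> \bar R) : Prop :=
  (forall (i : 'I_n) (B : set R), measurable B ->
     distribution P (X i) B = law B) /\
  (forall B : 'I_n -> set R, (forall i, measurable (B i)) ->
     P (\bigcap_(i in [set: 'I_n]) (X i @^-1` B i)) =
     (\prod_(i < n) P (X i @^-1` B i))%E).

Definition is_covering (R : realType) (F : set (R -> R)) (delta : R) (m : nat)
    (g : 'I_m -> R -> R) : Prop :=
  (forall j, F (g j)) /\
  (forall f, F f -> exists j : 'I_m,
     (TV (density_prob (g j)) (density_prob f) <= delta%:E)%E).

Definition is_minimal_covering (R : realType) (F : set (R -> R)) (delta : R)
    (m : nat) (g : 'I_m -> R -> R) : Prop :=
  is_covering F delta g /\
  (forall (m' : nat) (g' : 'I_m' -> R -> R),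
     is_covering F delta g' -> (m <= m')%N).

Definition empirical (R : realType) (n : nat) (x : 'I_n -> R) (A : set R) : R :=
  n%:R^-1 * \sum_(i < n) \1_A (x i).

(* [loses g x j k] is phi_{jk} computed from the sample [x]. *)
Definition loses (R : realType) (m n : nat) (g : 'I_m -> R -> R)
    (x : 'I_n -> R) (j k : 'I_m) : bool :=
  let A := [set y | 0 <= y <= 1 /\ g k y < g j y] in
  `|empirical x A - fine (density_prob (g k) A)| <
  `|empirical x A - fine (density_prob (g j) A)|.

Definition tournament_winner (R : realType) (m n : nat) (g : 'I_m -> R -> R)
    (x : 'I_n -> R) (j : 'I_m) : Prop :=
  forall j' : 'I_m, (\sum_(k < m | k != j) loses g x j k <=
                     \sum_(k < m | k != j') loses g x j' k)%N.

(* Ties may be broken in any measurable way. *)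
Definition tournament_estimator (R : realType) (d : measure_display)
    (T : measurableType d) (n : nat) (F : set (R -> R)) (delta : R)
    (X : 'I_n -> T -> R) (fhat : T -> R -> R) : Prop :=
  exists (m : nat) (g : 'I_m -> R -> R) (jhat : T -> 'I_m),
    [/\ is_minimal_covering F delta g,
        forall j, measurable (jhat @^-1` [set j]),
        forall w, tournament_winner g (fun i => X i w) (jhat w)
      & forall w, fhat w = g (jhat w)].

(* Main.v *)
Require Import Defs.
From HB Require Import structures.
From mathcomp Require Import all_boot all_order all_algebra.
From mathcomp Require Import all_classical all_reals all_analysis.
From mathcomp Require Import measurable_realfun zify ring lra.

Set Implicit Arguments.
Unset Strict Implicit.
Unset Printing Implicit Defensive.

Import Order.TTheory GRing.Theory Num.Theory.
Import numFieldNormedType.Exports.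

Local Open Scope classical_set_scope.
Local Open Scope ring_scope.

(** Every comparison made by the tournament involves one of the [m ^ 2] sets
    [A_jk], where [m] is the size of the minimal covering.  If the empirical
    frequency of each of them is within [t] of its probability under the
    sampling law, the outcome is determined up to a constant factor: the
    candidate nearest to [f] is within [delta + eps] of the sampling law, since
    contamination moves every probability by at most [eps], and a counting of
    losses ([tournament_winner_L1]) shows that no candidate much farther than
    [t + delta + eps] can win.

    The exceptional probability is at most [2 * m ^ 2 * exp (- n * t ^ 2 / 8)] by
    a union bound over a Hoeffding-type inequality ([empirical_deviation]).  With
    [r = n ^ (- beta / (2 * beta + 1))] and [t] a large multiple of [r + eps],
    the exponent is a large multiple of [n * r ^ 2 + n * eps ^ 2], and
    [n * r ^ 2 = n ^ (1 / (2 * beta + 1))].  It absorbs the factor [m ^ 2] as soon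
    as [log m] is of order [delta ^ (- 1 / beta)], that is, of order
    [n ^ (1 / (2 * beta + 1))].

    This entropy bound is [holder_covering].  It rests on orthonormality:
    on the unit interval the [L1] norm is at most the [L2] norm, hence at most
    the Euclidean norm of the coefficients ([L1_le_coefficients]), and rounding
    the coefficients of the levels below [L] leaves a code of [O (2 ^ L)] bits
    with an error of order [2 ^ (- beta * L)]. *)

(** * Concentration of empirical frequencies *)

Lemma expR_le_quadratic (R : realType) (l : R) :
  0 <= l <= 1 / 2 -> expR l <= 1 + l + 2 * l ^+ 2.
Proof.
move=> /andP[l0 l1].
have h : expR l * (1 - l) <= 1.
  apply: (@le_trans _ _ (expR l * expR (- l))).
    by rewrite ler_pM2l ?expR_gt0//; exact: expR_ge1Dx.
  by rewrite -expRD subrr expR0.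
have e0 := expR_gt0 l.
have l2 : 0 <= l ^+ 2 by rewrite sqr_ge0.
have hq : 1 <= (1 + l + 2 * l ^+ 2) * (1 - l).
  rewrite [leRHS](_ : _ = 1 + l ^+ 2 * (1 - 2 * l)); last by ring.
  by rewrite lerDl mulr_ge0//; lra.
have p : 0 < 1 - l by lra.
by rewrite -(ler_pM2r p); lra.
Qed.

Lemma bernoulli_mgf_le (R : realType) (p l : R) :
  0 <= p <= 1 -> 0 <= l <= 1 / 2 ->
  p * expR l + (1 - p) <= expR (p * l + 2 * l ^+ 2).
Proof.
move=> /andP[p0 p1] l01.
have h := expR_le_quadratic l01.
apply: le_trans (expR_ge1Dx _).
have l2 : 0 <= l ^+ 2 by rewrite sqr_ge0.
have h1 : p * expR l <= p * (1 + l + 2 * l ^+ 2) by rewrite ler_wpM2l.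
have h2 : p * l ^+ 2 <= l ^+ 2 by rewrite ler_piMl.
lra.
Qed.

Definition pattern_weight (R : realType) (n : nat) (p : R)
    (b : {ffun 'I_n -> bool}) : R :=
  \prod_(i < n) (if b i then p else 1 - p).

(** Chernoff's method: on the event that is summed, the factor
    [expR (t / 4 * (\sum_i b i - n * (p + t)))] is at least 1, and summing it
    over all patterns factorizes into [n] Bernoulli moment generating
    functions.  The parameter [t / 4] optimizes [- l * t + 2 * l ^+ 2]. *)
Lemma binomial_upper_tail (R : realType) (n : nat) (p t : R) :
  0 <= p <= 1 -> 0 <= t <= 1 ->
  \sum_(b : {ffun 'I_n -> bool} | n%:R * (p + t) <= \sum_(i < n) (b i)%:R)
     pattern_weight p b <= expR (- (n%:R * t ^+ 2 / 8)).
Proof.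
move=> p01 /andP[t0 t1].
have /andP[p0 p1] := p01.
have w0 (b : {ffun 'I_n -> bool}) : 0 <= pattern_weight p b.
  by apply: prodr_ge0 => i _; case: ifP => _; lra.
pose l := t / 4.
pose G (b : {ffun 'I_n -> bool}) :=
  pattern_weight p b * expR (l * (\sum_(i < n) (b i)%:R - n%:R * (p + t))).
have G0 b : 0 <= G b by rewrite mulr_ge0// expR_ge0.
apply: (@le_trans _ _ (\sum_b G b)).
  apply: (@le_trans _ _ (\sum_(b : {ffun 'I_n -> bool} |
      n%:R * (p + t) <= \sum_(i < n) (b i)%:R) G b)).
    apply: ler_sum => b hb; rewrite ler_peMr//.
    rewrite -[leLHS]expR0 ler_expR mulr_ge0//; first by rewrite /l; lra.
    by rewrite subr_ge0.
  by rewrite [leRHS](bigID (fun b : {ffun 'I_n -> bool} =>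
    n%:R * (p + t) <= \sum_(i < n) (b i)%:R)) /= lerDl sumr_ge0.
have -> : \sum_b G b =
    expR (- (l * (n%:R * (p + t)))) * (p * expR l + (1 - p)) ^+ n.
  have -> : (p * expR l + (1 - p)) ^+ n =
      \prod_(i < n) \sum_(c : bool) (if c then p * expR l else 1 - p).
    by rewrite (eq_bigr (fun=> p * expR l + (1 - p))) ?prodr_const ?card_ord// =>
      i _; rewrite big_bool.
  rewrite bigA_distr_bigA mulr_sumr; apply: eq_bigr => b _.
  rewrite /G mulrBr expRD mulrA mulrC; congr (_ * _).
  rewrite mulr_sumr expR_sum -big_split /=; apply: eq_bigr => i _.
  by case: (b i); rewrite ?mulr1// mulr0 expR0 mulr1.
have l01 : 0 <= l <= 1 / 2 by rewrite /l; lra.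
have hm := bernoulli_mgf_le p01 l01.
apply: (@le_trans _ _
    (expR (- (l * (n%:R * (p + t)))) * expR (p * l + 2 * l ^+ 2) ^+ n)).
  rewrite ler_pM2l ?expR_gt0// lerXn2r ?nnegrE ?expR_ge0//.
  by rewrite addr_ge0 ?mulr_ge0 ?expR_ge0//; lra.
rewrite -expRM_natl -expRD ler_expR le_eqVlt; apply/orP; left; apply/eqP.
by rewrite /l; field.
Qed.

Lemma probability_bigsetU_le (R : realType) (d : measure_display)
    (T : measurableType d) (P : probability T R) (I : Type) (s : seq I)
    (D : pred I) (A : I -> set T) :
  (forall i, measurable (A i)) ->
  (P (\big[setU/set0]_(i <- s | D i) A i) <= \sum_(i <- s | D i) P (A i))%E.
Proof.
move=> mA; elim: s => [|i s ih]; first by rewrite !big_nil measure0.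
rewrite !big_cons; case: ifP => // _.
apply: le_trans (leeD2l _ ih).
by apply: measureU2 => //; exact: bigsetU_measurable.
Qed.

Section empirical_concentration.
Variables (R : realType) (d : measure_display) (T : measurableType d).
Variables (P : probability T R) (n : nat) (X : 'I_n -> {RV P >-> R}).
Variables (law : set R -> \bar R).
Hypothesis iidX : iid_sample X law.

Let sample w := fun i => X i w.

Let pattern_event (A : set R) (b : {ffun 'I_n -> bool}) : set T :=
  \bigcap_(i in [set: 'I_n]) (X i @^-1` (if b i then A else ~` A)).

Let measurable_pattern A b : measurable A -> measurable (pattern_event A b).
Proof.
move=> mA; apply: fin_bigcap_measurable => // i _.
apply: measurable_funPTI; case: (b i) => //; exact: measurableC.
Qed.

Let probability_pattern A b p : measurable A -> law A = p%:E ->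
  P (pattern_event A b) = (pattern_weight p b)%:E.
Proof.
move=> mA lA; rewrite /pattern_event.
rewrite (iidX.2 (fun i => if b i then A else ~` A)); last first.
  by move=> i; case: (b i) => //; exact: measurableC.
rewrite /pattern_weight -prodEFin; apply: eq_bigr => i _.
have PA : P (X i @^-1` A) = p%:E by rewrite -lA -(iidX.1 i A mA).
case: (b i) => //.
by rewrite preimage_setC probability_setC ?PA//; exact: measurable_funPTI.
Qed.

(** The event only depends on which observations fall in [A]; decomposing it
    over these patterns reduces tail bounds to finite sums of products. *)
Lemma empirical_preimage A (U : set R) :
  [set w | U (empirical (sample w) A)] =
  \big[setU/set0]_(b : {ffun 'I_n -> bool} |
      `[< U (n%:R^-1 * \sum_(i < n) (b i)%:R) >]) pattern_event A b.
Proof.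
rewrite -(bigcup_pred [pred b : {ffun 'I_n -> bool} |
  `[< U (n%:R^-1 * \sum_(i < n) (b i)%:R) >]]).
apply/seteqP; split => [w Uw|w [b /= /asboolP Ub hb]].
  exists [ffun i : 'I_n => X i w \in A] => /=.
    apply/asboolP; move: Uw => /=.
    congr (U _); congr (_ * _); apply: eq_bigr => i _.
    by rewrite indicE ffunE.
  move=> i _ /=; rewrite ffunE.
  by case: ifPn => [/set_mem//|]; rewrite notin_setE.
move: Ub => /=; congr (U _); congr (_ * _); apply: eq_bigr => i _.
rewrite indicE; have /= := hb i I; case: (b i) => h; congr (_%:R).
  by rewrite mem_set.
by rewrite memNset.
Qed.

Lemma measurable_empirical A (U : set R) : measurable A ->
  measurable [set w | U (empirical (sample w) A)].
Proof.
move=> mA; rewrite empirical_preimage.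
by apply: bigsetU_measurable => b _; exact: measurable_pattern.
Qed.

Lemma empirical_upper_tail A (p t : R) : (0 < n)%N -> measurable A ->
  law A = p%:E -> 0 <= p <= 1 -> 0 <= t ->
  (P [set w | (p + t <= empirical (sample w) A)%R] <=
     (expR (- (n%:R * t ^+ 2 / 8)))%:E)%E.
Proof.
move=> n0 mA lA p01 t0.
have nR : 0 < n%:R :> R by rewrite ltr0n.
have [t1|t1] := leP t 1; last first.
  (* a frequency cannot exceed [p + t > 1] *)
  rewrite (_ : [set w | _] = set0) ?measure0 ?lee_fin ?expR_ge0//.
  apply/seteqP; split => // w /= h.
  have : empirical (sample w) A <= 1.
    rewrite /empirical ler_pdivrMl// mulr1 -[leRHS]/(n%:R).
    rewrite (_ : n%:R = \sum_(i < n) 1); last by rewrite sumr_const card_ord.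
    by apply: ler_sum => i _; rewrite indicE; case: (_ \in _).
  by lra.
rewrite (empirical_preimage A [set v | p + t <= v]).
apply: le_trans (probability_bigsetU_le _ _ _ _) _.
  by move=> b; exact: measurable_pattern.
apply: le_trans (_ : _ <= (\sum_(b : {ffun 'I_n -> bool} |
    (n%:R * (p + t) <= \sum_(i < n) (b i)%:R)%R) pattern_weight p b)%:E)%E _.
  rewrite -sumEFin le_eqVlt; apply/orP; left; apply/eqP.
  apply: eq_big => [b|b _]; last exact: probability_pattern.
  by apply/asboolP/idP => /=; rewrite ler_pdivlMl.
by rewrite lee_fin binomial_upper_tail// t0 t1.
Qed.

(** The lower tail of [A] is the upper tail of its complement. *)
Lemma empirical_deviation A (p t : R) : (0 < n)%N -> measurable A ->
  law A = p%:E -> 0 <= p <= 1 -> 0 <= t ->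
  (P [set w | (t <= `|empirical (sample w) A - p|)%R] <=
     (2 * expR (- (n%:R * t ^+ 2 / 8)))%R%:E)%E.
Proof.
move=> n0 mA lA p01 t0.
have nR : 0 < n%:R :> R by rewrite ltr0n.
have mAc : measurable (~` A) by exact: measurableC.
have lAc : law (~` A) = (1 - p)%:E.
  rewrite -(iidX.1 (Ordinal n0) _ mAc) /distribution /pushforward.
  rewrite preimage_setC probability_setC; last exact: measurable_funPTI.
  by rewrite EFinB -lA -(iidX.1 (Ordinal n0) _ mA).
have eC w : empirical (sample w) (~` A) = 1 - empirical (sample w) A.
  rewrite /empirical -[X in X - _](mulVf (lt0r_neq0 nR)) -mulrBr; congr (_ * _).
  rewrite -[X in X - _](_ : \sum_(i < n) 1 = _); last by rewrite sumr_const card_ord.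
  rewrite -sumrB; apply: eq_bigr => i _; rewrite !indicE in_setC.
  by case: (_ \in _); rewrite ?subrr ?subr0.
have m1 : measurable [set w | p + t <= empirical (sample w) A].
  exact: (measurable_empirical [set v | p + t <= v] mA).
have m2 : measurable [set w | 1 - p + t <= empirical (sample w) (~` A)].
  exact: (measurable_empirical [set v | 1 - p + t <= v] mAc).
apply: (@le_trans _ _ (P ([set w | p + t <= empirical (sample w) A] `|`
    [set w | 1 - p + t <= empirical (sample w) (~` A)]))).
  apply: le_measure; rewrite ?inE.
  - exact: (measurable_empirical [set v | t <= `|v - p|] mA).
  - exact: measurableU.
  - move=> w /=; rewrite eC => h.
    have [q|q] := leP p (empirical (sample w) A).
      by left; move: h; rewrite ger0_norm ?subr_ge0// => h; lra.
    by right; move: h; rewrite ltr0_norm ?subr_lt0// => h; lra.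
apply: le_trans (measureU2 _ m1 m2) _.
rewrite mulr_natl mulr2n EFinD.
apply: leeD; first exact: empirical_upper_tail.
by apply: empirical_upper_tail => //; lra.
Qed.

End empirical_concentration.

(** * Densities on the unit interval *)

Definition unit_density (R : realType) (f : R -> R) : Prop :=
  [/\ measurable_fun (`[0, 1] : set R) f,
      forall x, 0 <= x <= 1 -> 0 <= f x
    & (\int[@lebesgue_measure R]_(x in `[0%R, 1%R]) (f x)%:E = 1)%E].

Section densities.
Variable R : realType.
Implicit Types (f g h : R -> R) (A : set (measurableTypeR R)).

Let mu := @lebesgue_measure R.
Let I01 : set (measurableTypeR R) := `[0, 1]%classic.

Definition mass f A : R := fine (density_prob f A).

Definition L1 f g : R := \int[mu]_(x in I01) `|f x - g x|.

Let mI : measurable I01. Proof. exact: measurable_itv. Qed.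

Lemma unit_density_integrable f : unit_density f -> mu.-integrable I01 (EFin \o f).
Proof.
case=> mf f0 f1; apply/integrableP; split; first exact/measurable_EFinP.
under eq_integral => x xI.
  rewrite /= ger0_norm; last first.
    by apply: f0; move: xI; rewrite inE /I01 /= in_itv.
  over.
by rewrite f1 ltry.
Qed.

Let integrableSI A (u : R -> R) : measurable A -> mu.-integrable I01 (EFin \o u) ->
  mu.-integrable (I01 `&` A) (EFin \o u).
Proof.
move=> mA; apply: integrableS => //; exact: measurableI.
Qed.

Let integrableB_density f g : unit_density f -> unit_density g ->
  mu.-integrable I01 (EFin \o (fun x => f x - g x)).
Proof.
move=> df dg.
by have := integrableB mI (unit_density_integrable df) (unit_density_integrable dg).
Qed.

Let integrable_absB f g : unit_density f -> unit_density g ->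
  mu.-integrable I01 (EFin \o (fun x => `|f x - g x|)).
Proof. by move=> df dg; have := integrable_norm (integrableB_density df dg). Qed.

Lemma mass_Rintegral f A : mass f A = \int[mu]_(x in I01 `&` A) f x.
Proof. by []. Qed.

Lemma density_probE f A : unit_density f -> measurable A ->
  density_prob f A = (mass f A)%:E.
Proof.
move=> df mA; rewrite /mass fineK//.
apply: integrable_fin_num; first exact: measurableI.
exact: integrableSI mA (unit_density_integrable df).
Qed.

Lemma mass_itv01 f A : unit_density f -> measurable A -> 0 <= mass f A <= 1.
Proof.
move=> df mA; have [mf f0 f1] := df.
apply/andP; split.
  by apply: Rintegral_ge0 => x [+ _]; rewrite /I01 /= in_itv; exact: f0.
rewrite -lee_fin -density_probE// -f1 /density_prob.
apply: ge0_subset_integral => //; first exact: measurableI.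
exact/measurable_EFinP.
Qed.

Lemma L1_distE f g : unit_density f -> unit_density g ->
  L1_dist f g = (L1 f g)%:E.
Proof.
move=> df dg; rewrite /L1 /Rintegral fineK//.
apply: integrable_fin_num => //; exact: integrable_absB.
Qed.

Lemma L1_ge0 f g : 0 <= L1 f g.
Proof. exact: Rintegral_ge0. Qed.

Lemma L1C f g : L1 f g = L1 g f.
Proof. by apply: eq_Rintegral => x _; rewrite distrC. Qed.

Lemma L1xx f : L1 f f = 0.
Proof.
rewrite /L1 -[RHS](mul0r (fine (mu I01))) -Rintegral_cst//.
by apply: eq_Rintegral => x _; rewrite subrr normr0.
Qed.

Lemma L1_dist_triangle g f h : measurable_fun I01 f -> measurable_fun I01 g ->
  measurable_fun I01 h -> (L1_dist f h <= L1_dist f g + L1_dist g h)%E.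
Proof.
move=> mf mg mh.
have mB (u v : R -> R) : measurable_fun I01 u -> measurable_fun I01 v ->
    measurable_fun I01 (fun x => (`|u x - v x|%R)%:E).
  move=> mu' mv; apply/measurable_EFinP; apply: measurableT_comp => //.
  exact: measurable_funB.
rewrite /L1_dist -ge0_integralD//; try exact: mB.
apply: ge0_le_integral => //; first exact: mB.
- by apply: emeasurable_funD; exact: mB.
- by move=> x _; rewrite -EFinD lee_fin; exact: ler_distD.
Qed.

Lemma L1_triangle g f h : unit_density f -> unit_density g -> unit_density h ->
  L1 f h <= L1 f g + L1 g h.
Proof.
move=> df dg dh; rewrite -lee_fin EFinD -!L1_distE//.
by case: df dg dh => mf _ _ [mg _ _] [mh _ _]; exact: L1_dist_triangle.
Qed.

Lemma mass_dist_le_L1 f g A : unit_density f -> unit_density g ->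
  measurable A -> `|mass f A - mass g A| <= L1 f g.
Proof.
move=> df dg mA; have mIA : measurable (I01 `&` A) by exact: measurableI.
rewrite !mass_Rintegral -RintegralB//; last 2 first.
- exact: integrableSI (unit_density_integrable df).
- exact: integrableSI (unit_density_integrable dg).
apply: le_trans (le_normr_Rintegral _ (integrableSI mA (integrableB_density df dg))) _ => //.
rewrite -lee_fin /L1 /Rintegral !fineK; last 2 first.
- apply: integrable_fin_num => //; exact: integrable_absB.
- apply: integrable_fin_num => //; apply: integrableSI => //; exact: integrable_absB.
apply: ge0_subset_integral => //.
by have /integrableP[] := integrable_absB df dg.
Qed.

Lemma measurable_density_gt f g : unit_density f -> unit_density g ->
  measurable [set y | 0 <= y <= 1 /\ g y < f y].
Proof.
move=> [mf _ _] [mg _ _].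
rewrite (_ : [set y | _] = I01 `&` [set y | (g y < f y)]); last first.
  by apply/seteqP; split=> y /=; rewrite /I01 /= in_itv.
have := measurable_fun_ltr mg mf mI (I : measurable [set true]).
congr measurable; congr (_ `&` _); apply/seteqP; split => y //=.
Qed.

(** Two densities have the same total mass, so their difference integrates to
    zero and the set where the first exceeds the second carries exactly half
    of the [L1] distance. *)
Lemma mass_density_gt f g : unit_density f -> unit_density g ->
  let A := [set y | 0 <= y <= 1 /\ g y < f y] in
  mass f A - mass g A = L1 f g / 2.
Proof.
move=> df dg A; have mA : measurable A by exact: measurable_density_gt.
have [_ _ f1] := df; have [_ _ g1] := dg.
have mIA : measurable (I01 `&` A) by exact: measurableI.
have mID : measurable (I01 `&` ~` A) by apply: measurableI => //; exact: measurableC.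
have dis : [disjoint I01 `&` A & I01 `&` ~` A]%classic.
  by apply/disj_setPS => y [[_ h] [_ /(_ h)]].
have eI : I01 = (I01 `&` A) `|` (I01 `&` ~` A).
  by rewrite -setIUr setUv setIT.
have iB := integrableB_density df dg.
have iN := integrable_absB df dg.
have split_int (u : R -> R) : mu.-integrable I01 (EFin \o u) ->
    \int[mu]_(x in I01) u x =
    \int[mu]_(x in I01 `&` A) u x + \int[mu]_(x in I01 `&` ~` A) u x.
  by move=> iu; rewrite {1}eI Rintegral_setU// -eI.
have zero : \int[mu]_(x in I01) (f x - g x) = 0.
  rewrite RintegralB//; try exact: unit_density_integrable.
  by rewrite /Rintegral f1 g1 subrr.
have pos : \int[mu]_(x in I01 `&` A) `|f x - g x| =
           \int[mu]_(x in I01 `&` A) (f x - g x).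
  apply: eq_Rintegral => x; rewrite inE => -[_ [_ h]].
  by rewrite gtr0_norm// subr_gt0.
have neg : \int[mu]_(x in I01 `&` ~` A) `|f x - g x| =
           - \int[mu]_(x in I01 `&` ~` A) (f x - g x).
  rewrite -mulN1r -RintegralZl//; last exact: integrableSI (measurableC mA) iB.
  apply: eq_Rintegral => x; rewrite inE => -[xI h].
  rewrite mulN1r ler0_norm// subr_le0 leNgt; apply/negP => gf; apply: h.
  by split => //; move: xI; rewrite /I01 /= in_itv.
have onA : \int[mu]_(x in I01 `&` A) (f x - g x) = mass f A - mass g A.
  by rewrite RintegralB//; apply: integrableSI => //; exact: unit_density_integrable.
have := split_int _ iN; rewrite pos neg onA -/(L1 f g).
have := split_int _ iB; rewrite zero onA.
by lra.
Qed.

Lemma TV_le_L1 f g : unit_density f -> unit_density g ->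
  (TV (density_prob f) (density_prob g) <= (L1 f g)%:E)%E.
Proof.
move=> df dg; apply: ge_ereal_sup.
move=> _ [A mA <-]; rewrite !density_probE// -EFinB abse_EFin lee_fin.
exact: mass_dist_le_L1.
Qed.

Lemma mass_dist_le_TV f g A delta : unit_density f -> unit_density g ->
  (TV (density_prob f) (density_prob g) <= delta%:E)%E -> measurable A ->
  `|mass f A - mass g A| <= delta.
Proof.
move=> df dg h mA; rewrite -lee_fin; apply: le_trans h.
by apply: ereal_sup_ubound; exists A => //; rewrite !density_probE.
Qed.

Lemma L1_le_TV f g delta : unit_density f -> unit_density g ->
  (TV (density_prob f) (density_prob g) <= delta%:E)%E -> L1 f g <= 2 * delta.
Proof.
move=> df dg h.
have := mass_dist_le_TV df dg h (measurable_density_gt df dg).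
rewrite mass_density_gt// ger0_norm; last by rewrite divr_ge0// L1_ge0.
lra.
Qed.

End densities.

(** * From wavelet coefficients to the L1 distance *)

Section orthonormal.
Variable R : realType.
Implicit Types (f g h : R -> R).

Let mu := @lebesgue_measure R.
Let I01 : set (measurableTypeR R) := `[0, 1]%classic.

Let mI : measurable I01. Proof. exact: measurable_itv. Qed.

Let mu1 : (mu I01 = 1)%E.
Proof. by rewrite /mu /I01 lebesgue_measure_itv /= lte_fin ltr01 -EFinB subr0. Qed.

(** The Cauchy-Schwarz inequality on a probability space, obtained by
    integrating [2 * s * `|u| <= s ^+ 2 + u ^+ 2] for [u = f - g]. *)
Lemma L1_dist_le_L2 f g (s : R) : measurable_fun I01 f -> measurable_fun I01 g ->
  0 < s -> (\int[mu]_(x in I01) ((f x - g x) ^+ 2)%:E <= (s ^+ 2)%:E)%E ->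
  (L1_dist f g <= s%:E)%E.
Proof.
move=> mf mg s0 hs.
have mB : measurable_fun I01 (fun x => f x - g x) by exact: measurable_funB.
have mB2 : measurable_fun I01 (fun x => ((f x - g x) ^+ 2)%:E).
  by apply/measurable_EFinP; exact: measurable_funX.
have k0 : 0 <= (2 * s)^-1 by rewrite invr_ge0; lra.
apply: (@le_trans _ _ (\int[mu]_(x in I01)
    ((s / 2)%:E + (2 * s)^-1%:E * ((f x - g x) ^+ 2)%:E))%E).
  apply: ge0_le_integral => //.
  - by apply/measurable_EFinP; exact: measurableT_comp.
  - apply: emeasurable_funD; first exact: measurable_cst.
    exact: measurable_funeM.
  - move=> x _; rewrite -EFinM -EFinD lee_fin.
    have d0 : 0 < 2 * s by lra.
    rewrite -(ler_pM2l d0) mulrDr mulVKf ?lt0r_neq0//.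
    have := sqr_ge0 (s - `|f x - g x|).
    by rewrite sqrrB real_normK ?num_real// => q; lra.
rewrite ge0_integralD//; last 3 first.
- by move=> x _; rewrite lee_fin; lra.
- by move=> x _; rewrite -EFinM lee_fin mulr_ge0// sqr_ge0.
- exact: measurable_funeM.
rewrite integral_cst//; rewrite [X in ((s / 2)%:E * X)%E]mu1 mule1.
rewrite ge0_integralZl_EFin//; last first.
  by move=> x _; rewrite lee_fin sqr_ge0.
apply: (@le_trans _ _ ((s / 2)%:E + (2 * s)^-1%:E * (s ^+ 2)%:E)%E).
  by rewrite leeD2l// lee_wpmul2l.
rewrite -EFinM -EFinD lee_fin le_eqVlt; apply/orP; left; apply/eqP.
by field; rewrite lt0r_neq0.
Qed.

Lemma Rintegral_sum_seq (I : eqType) (r : seq I) (F : I -> R -> R) :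
  (forall i, i \in r -> mu.-integrable I01 (EFin \o F i)) ->
  mu.-integrable I01 (EFin \o (fun x => \sum_(i <- r) F i x)) /\
  \int[mu]_(x in I01) (\sum_(i <- r) F i x) =
  \sum_(i <- r) \int[mu]_(x in I01) F i x.
Proof.
elim: r => [|i r ih] iF.
  split; last first.
    under eq_Rintegral do rewrite big_nil.
    by rewrite big_nil Rintegral_cst// mul0r.
  apply: (eq_integrable mI _ _ _ (integrable0 _ _)).
  by move=> x _ /=; rewrite big_nil.
have [iS eS] := ih (fun j jr => iF j (@mem_behead _ (i :: r) j jr)).
have iFi := iF i (mem_head _ _).
split.
  apply: (eq_integrable mI _ _ _ (integrableD mI iFi iS)).
  by move=> x _ /=; rewrite big_cons EFinD.
under eq_Rintegral do rewrite big_cons.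
by rewrite RintegralD// big_cons eS.
Qed.

Variable psi : nat -> nat -> R -> R.
Hypothesis psi_onb : orthonormal_basis01 psi.

Definition wavelet_indices (L : nat) : seq (nat * nat) :=
  [seq (l, k) | l <- iota 0 L, k <- iota 0 (2 ^ l)].

Lemma mem_wavelet_indices L p :
  (p \in wavelet_indices L) = (p.1 < L)%N && (p.2 < 2 ^ p.1)%N.
Proof.
apply/allpairsPdep/idP => [[l [k [hl hk ->]]]|/andP[h1 h2]].
  by move: hl hk; rewrite !mem_iota !add0n /= => -> ->.
by exists p.1, p.2; rewrite !mem_iota !add0n; split => //; case: p {h1 h2}.
Qed.

Lemma wavelet_indices_uniq L : uniq (wavelet_indices L).
Proof.
apply: allpairs_uniq_dep => [|l _|]; try exact: iota_uniq.
by move=> [l k] [l' k'] _ _ /= [-> ->].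
Qed.

Lemma big_wavelet_indices (V : Type) (idx : V) (op : Monoid.law idx)
    (L : nat) (F : nat -> nat -> V) :
  \big[op/idx]_(p <- wavelet_indices L) F p.1 p.2 =
  \big[op/idx]_(0 <= l < L) \big[op/idx]_(0 <= k < 2 ^ l) F l k.
Proof.
by rewrite big_allpairs_dep /index_iota subn0; apply: eq_bigr => l _; rewrite subn0.
Qed.

Lemma wavelet_partial_sumE c L x : wavelet_partial_sum psi c L x =
  \sum_(p <- wavelet_indices L) c p.1 p.2 * psi p.1 p.2 x.
Proof. by rewrite (big_wavelet_indices _ _ (fun l k => c l k * psi l k x)). Qed.

Let mpsi l k : (k < 2 ^ l)%N -> measurable_fun I01 (psi l k).
Proof. by case: psi_onb => h _ _ /h[]. Qed.

Lemma measurable_wavelet_partial_sum c L :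
  measurable_fun I01 (wavelet_partial_sum psi c L).
Proof.
pose F (p : nat * nat) x :=
  if (p.2 < 2 ^ p.1)%N then c p.1 p.2 * psi p.1 p.2 x else 0.
apply: (eq_measurable_fun (fun x => \sum_(p <- wavelet_indices L) F p x)).
  move=> x _; rewrite wavelet_partial_sumE; apply: eq_big_seq => -[l k].
  by rewrite mem_wavelet_indices /F => /andP[_ ->].
apply: measurable_sum => p; rewrite /F; case hp: (p.2 < 2 ^ p.1)%N => //.
by apply: measurable_funM => //; exact: mpsi.
Qed.

Let integrable_psi_mul p q : (p.2 < 2 ^ p.1)%N -> (q.2 < 2 ^ q.1)%N ->
  mu.-integrable I01 (EFin \o (fun x => psi p.1 p.2 x * psi q.1 q.2 x)).
Proof.
move=> hp hq; have [hS _ _] := psi_onb.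
have iS r : (r.2 < 2 ^ r.1)%N ->
    mu.-integrable I01 (EFin \o (fun x => psi r.1 r.2 x ^+ 2)).
  move=> /hS[mr fr]; apply/integrableP; split.
    by apply/measurable_EFinP; exact: measurable_funX.
  by under eq_integral do rewrite /= ger0_norm ?sqr_ge0//.
apply: (le_integrable mI _ _ (integrableD mI (iS p hp) (iS q hq))).
  by apply/measurable_EFinP; apply: measurable_funM; exact: mpsi.
move=> x _ /=; rewrite lee_fin.
set a := psi _ _ x; set b := psi _ _ x.
rewrite [leRHS]ger0_norm ?addr_ge0 ?sqr_ge0// normrM.
have := sqr_ge0 (`|a| - `|b|).
rewrite sqrrB !real_normK ?num_real//.
have := sqr_ge0 a; have := sqr_ge0 b.
lra.
Qed.

Lemma parseval_partial_sum c L :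
  (\int[mu]_(x in I01) (wavelet_partial_sum psi c L x ^+ 2)%:E =
   (\sum_(p <- wavelet_indices L) c p.1 p.2 ^+ 2)%:E)%E.
Proof.
set S := wavelet_indices L.
pose F (pq : (nat * nat) * (nat * nat)) (x : R) :=
  c pq.1.1 pq.1.2 * c pq.2.1 pq.2.2 * (psi pq.1.1 pq.1.2 x * psi pq.2.1 pq.2.2 x).
have eF x : wavelet_partial_sum psi c L x ^+ 2 =
    \sum_(pq <- [seq (p, q) | p <- S, q <- S]) F pq x.
  rewrite big_allpairs expr2 wavelet_partial_sumE mulr_suml.
  apply: eq_bigr => p _; rewrite mulr_sumr; apply: eq_bigr => q _.
  by rewrite /F /=; ring.
have valid pq : pq \in [seq (p, q) | p <- S, q <- S] ->
    (pq.1.2 < 2 ^ pq.1.1)%N /\ (pq.2.2 < 2 ^ pq.2.1)%N.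
  move=> /allpairsP[[p q] [/= hp hq ->]]; move: hp hq.
  by rewrite !mem_wavelet_indices => /andP[_ hp] /andP[_ hq].
have iF pq : pq \in [seq (p, q) | p <- S, q <- S] ->
    mu.-integrable I01 (EFin \o F pq).
  by move=> /valid[hp hq]; have := integrableZl mI (c pq.1.1 pq.1.2 * c pq.2.1 pq.2.2)
    (integrable_psi_mul hp hq).
have [iS eS] := Rintegral_sum_seq iF.
under eq_integral do rewrite eF.
rewrite -[LHS]fineK; last exact: integrable_fin_num iS.
congr (_%:E); rewrite -/(Rintegral _ _ _) eS big_allpairs.
rewrite big_seq [RHS]big_seq; apply: eq_bigr => p pS.
have inn q : q \in S -> \int[mu]_(x in I01) F (p, q) x =
    c p.1 p.2 * c q.1 q.2 * (p == q)%:R.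
  move=> qS; have [/= hp hq] : (p.2 < 2 ^ p.1)%N /\ (q.2 < 2 ^ q.1)%N.
    by apply: (valid (p, q)); apply/allpairsP; exists (p, q).
  rewrite RintegralZl//; last exact: integrable_psi_mul.
  have [_ /(_ _ _ _ _ hp hq) hpq _] := psi_onb; rewrite /inner in hpq.
  by rewrite hpq -!surjective_pairing.
rewrite (bigD1_seq p) ?wavelet_indices_uniq//= inn// eqxx mulr1 -expr2.
rewrite big_seq_cond big1 ?addr0// => q /andP[qS qp].
by rewrite inn// eq_sym (negbTE qp) mulr0.
Qed.

(** Truncating both expansions at a level where the remainders are negligible
    reduces the bound to Parseval's identity for a finite sum. *)
Lemma L1_le_coefficients f g c c' (s : R) :
  unit_density f -> unit_density g ->
  L2_expansion psi c f -> L2_expansion psi c' g -> 0 < s ->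
  (forall L, \sum_(p <- wavelet_indices L) (c p.1 p.2 - c' p.1 p.2) ^+ 2 <= s ^+ 2) ->
  L1 f g <= s.
Proof.
move=> df dg ef eg s0 hs; have [mf _ _] := df; have [mg _ _] := dg.
apply/ler_addgt0Pr => e e0; rewrite -lee_fin -L1_distE//.
have e2 : 0 < e / 2 by lra.
have e4 : (0 < ((e / 2) ^+ 2)%:E :> \bar R)%E by rewrite lte_fin exprn_gt0.
have close h d : L2_expansion psi d h -> \forall L \near \oo,
    (\int[mu]_(x in I01) ((h x - wavelet_partial_sum psi d L x) ^+ 2)%:E
       <= ((e / 2) ^+ 2)%:E)%E.
  move=> hd; near=> L; apply: ltW; near: L.
  by have := hd _ (open_ereal_lt' e4).
have /filter_ex[L [hf hg]] : \forall L \near \oo,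
    (\int[mu]_(x in I01) ((f x - wavelet_partial_sum psi c L x) ^+ 2)%:E
       <= ((e / 2) ^+ 2)%:E)%E /\
    (\int[mu]_(x in I01) ((g x - wavelet_partial_sum psi c' L x) ^+ 2)%:E
       <= ((e / 2) ^+ 2)%:E)%E.
  by apply: filterI; exact: close.
have mc d := measurable_wavelet_partial_sum d L.
apply: le_trans (L1_dist_triangle mf (mc c) mg) _.
apply: le_trans (leeD2l _ (L1_dist_triangle (mc c) (mc c') mg)) _.
have df' := L1_dist_le_L2 mf (mc c) e2 hf.
have dg' : (L1_dist (wavelet_partial_sum psi c' L) g <= (e / 2)%:E)%E.
  apply: L1_dist_le_L2 => //; apply: le_trans hg.
  by under eq_integral do rewrite -sqrrN opprB.
have dm : (L1_dist (wavelet_partial_sum psi c L) (wavelet_partial_sum psi c' L) <= s%:E)%E.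
  apply: L1_dist_le_L2 => //.
  have -> : (\int[mu]_(x in I01) ((wavelet_partial_sum psi c L x -
      wavelet_partial_sum psi c' L x) ^+ 2)%:E =
      \int[mu]_(x in I01) ((wavelet_partial_sum psi (fun l k => (c l k - c' l k)%R) L x) ^+ 2)%:E)%E.
    apply: eq_integral => x _; congr ((_ ^+ 2)%:E).
    rewrite !wavelet_partial_sumE -sumrB; apply: eq_bigr => p _.
    by rewrite mulrBl.
  by rewrite parseval_partial_sum lee_fin.
apply: le_trans (leeD df' (leeD dm dg')) _.
by rewrite -!EFinD lee_fin; lra.
Unshelve. all: by end_near.
Qed.

End orthonormal.

(** * Metric entropy of the Holder class *)

(** Writing the digits in mixed radix numbers the digit strings without gaps,
    which avoids finite types of dependent functions. *)
Lemma mixed_radix (T : Type) (I : eqType) (r : seq I) (D : T -> Prop)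
    (q : T -> I -> nat) (N : I -> nat) :
  (forall t i, D t -> i \in r -> (q t i < N i)%N) ->
  exists code : T -> nat,
    (forall t, D t -> (code t < \prod_(i <- r) N i)%N) /\
    forall t t', D t -> D t' -> code t = code t' ->
      forall i, i \in r -> q t i = q t' i.
Proof.
elim: r => [|i r ih] hq.
  by exists (fun=> 0%N); split => // t _; rewrite big_nil.
have [t j Dt jr|code [code_lt code_inj]] := ih.
  by apply: hq => //; rewrite inE jr orbT.
have qi t : D t -> (q t i < N i)%N by move=> Dt; apply: hq; rewrite ?mem_head.
exists (fun t => code t * N i + q t i)%N; split => [t Dt|t t' Dt Dt' e j].
  rewrite big_cons [ltnRHS]mulnC; apply: (@leq_trans ((code t).+1 * N i)%N).
    by rewrite mulSn addnC ltn_add2r qi.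
  by rewrite leq_mul2r code_lt// orbT.
have N0 : (0 < N i)%N by exact: leq_ltn_trans (qi t Dt).
have ec : code t = code t'.
  by have := congr1 (divn^~ (N i)) e; rewrite !divnMDl// !divn_small ?addn0 ?qi.
rewrite inE => /orP[/eqP->|jr]; last exact: code_inj.
by move: e; rewrite ec => /addnI.
Qed.

(** The centres of a covering must belong to the class, so each cell is
    represented by one of its members; unattained codes reuse [t0]. *)
Lemma code_representatives (T : Type) (D : T -> Prop) (K : nat)
    (code : T -> nat) (t0 : T) :
  D t0 -> (forall t, D t -> (code t < K)%N) ->
  exists g : 'I_K -> T, (forall j, D (g j)) /\
    forall t, D t -> exists j, code (g j) = code t.
Proof.
move=> Dt0 codeK.
have /choice[g hg] (j : 'I_K) : exists u, D u /\
    ((exists2 t, D t & code t = j) -> code u = j).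
  have [[t Dt ct]|no] := pselect (exists2 t, D t & code t = j).
    by exists t.
  by exists t0; split.
exists g; split => [j|t Dt]; first by case: (hg j).
exists (Ordinal (codeK t Dt)).
by case: (hg (Ordinal (codeK t Dt))) => _; apply; exists t.
Qed.

(** The sum falls short of the bound by exactly [a * L + 2 * a + 2], an identity
    that an induction on [L] can carry. *)
Lemma digit_budget (a L : nat) :
  (\sum_(0 <= l < L) 2 ^ l * (a * (L - l) + 2) <= (2 * a + 2) * 2 ^ L)%N.
Proof.
suff : (\sum_(0 <= l < L) 2 ^ l * (a * (L - l) + 2) + a * L + 2 * a + 2 =
    (2 * a + 2) * 2 ^ L)%N by move=> <-; rewrite -!addnA leq_addr.
elim: L => [|L ih]; first by rewrite big_geq// muln0 muln1.
rewrite big_nat_recl// expn0 mul1n subn0.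
under eq_bigr do rewrite subSS expnS -mulnA.
rewrite -big_distrr /= expnS [RHS]mulnCA -ih.
by lia.
Qed.

(** The levels below the cut-off contribute a full geometric sum of ratio 2,
    dominated by its last term; those above it a convergent one, dominated by
    its first term. *)
Lemma two_regime_sum (R : realType) (t : nat -> R) (B C v : R) (L n : nat) :
  0 <= B -> 0 <= C -> 0 <= v < 1 ->
  (forall l, (l < L)%N -> t l <= 2 ^+ l * B) ->
  (forall l, (L <= l)%N -> t l <= C * v ^+ l) ->
  \sum_(0 <= l < n) t l <= 2 ^+ L * B + C / (1 - v) * v ^+ L.
Proof.
move=> B0 C0 /andP[v0 v1] low high.
have v1' : 0 < 1 - v by lra.
have D0 : 0 <= C / (1 - v) by rewrite divr_ge0// ltW.
have vL k : 0 <= v ^+ k by rewrite exprn_ge0.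
have lowsum m : (m <= L)%N -> \sum_(0 <= l < m) t l <= 2 ^+ m * B.
  elim: m => [|m ih] mL; first by rewrite big_geq// mulr_ge0// exprn_ge0.
  rewrite big_nat_recr//=; have := ih (ltnW mL); have := low m mL.
  by rewrite exprS; lra.
have highsum k : \sum_(0 <= l < L + k) t l <=
    2 ^+ L * B + C / (1 - v) * (v ^+ L - v ^+ (L + k)).
  elim: k => [|k ih]; first by rewrite addn0 subrr mulr0 addr0 lowsum.
  rewrite addnS big_nat_recr//=.
  have := high (L + k)%N (leq_addr _ _) => h.
  have e : C * v ^+ (L + k) = C / (1 - v) * (v ^+ (L + k) - v ^+ (L + k).+1).
    by rewrite exprS; field; rewrite lt0r_neq0.
  rewrite e in h; apply: le_trans (lerD ih h) _.
  by rewrite le_eqVlt; apply/orP; left; apply/eqP; ring.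
have [nL|/ltnW Ln] := leqP n L.
  apply: le_trans (lowsum n nL) _.
  apply: (@le_trans _ _ (2 ^+ L * B)); last by rewrite lerDl mulr_ge0.
  by rewrite ler_wpM2r// ler_weXn2l// ler1n.
rewrite -(subnKC Ln); apply: le_trans (highsum _) _.
by rewrite lerD2l ler_wpM2l// gerBl.
Qed.

Lemma holder_unit_density (R : realType) psi (beta M : R) f :
  holder_density psi beta M f -> unit_density f.
Proof. by case. Qed.

(** Coefficients of level [l] range over [-M / Z ^+ l, M / Z ^+ l] with
    [Z = 2 `^ (1/2 + beta)].  Below level [L] all of them are rounded at the same
    precision [M / Z ^+ L], their range at level [L], so that each coefficient of
    level [l] takes about [(L - l) * (1/2 + beta)] bits; from level [L] on they
    are ignored.  The rounding and truncation errors are then of the same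
    order.  As the few coefficients of the low levels are the ones that take
    many bits, the total is a multiple of [2 ^ L], without the factor [L] that
    would come from allotting the largest number of bits to every level. *)
Lemma holder_covering (R : realType) psi (beta M : R) :
  orthonormal_basis01 psi -> 0 < beta -> 0 < M ->
  exists (K : R) (a : nat), 0 < K /\ forall (L : nat) (delta : R) f0,
    holder_density psi beta M f0 -> 0 < delta ->
    K * (2 `^ (- (2 * beta))) ^+ L <= delta ^+ 2 ->
    exists g : 'I_(2 ^ ((2 * a + 2) * 2 ^ L)) -> R -> R,
      is_covering (holder_density psi beta M) delta g.
Proof.
move=> onb b0 M0.
pose Z : R := 2 `^ (2^-1 + beta).
pose v : R := 2 `^ (- (2 * beta)).
have Z0 : 0 < Z by exact: powR_gt0.
have v0 : 0 < v by exact: powR_gt0.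
have pow_gt1 r : 0 < r -> 1 < 2 `^ r :> R.
  move=> r0; have -> : 1 < 2 `^ r = (1 `^ r < 2 `^ r :> R) by rewrite powR1.
  by apply: gt0_ltr_powR; rewrite ?nnegrE ?ltr1n.
have Z1 : 1 < Z by apply: pow_gt1; lra.
have vZ : v = 2 / Z ^+ 2.
  rewrite /Z -powR_mulrn ?powR_ge0// -powRrM -powRN.
  rewrite -[X in _ = X * _]powRr1// -powRD; last by rewrite pnatr_eq0 implybT.
  by rewrite /v; congr (_ `^ _); field.
have v1 : v < 1.
  rewrite /v powRN invf_lt1 ?powR_gt0//.
  by apply: pow_gt1; lra.
pose a := (Num.trunc (2^-1 + beta)).+1.
have Za : Z <= 2 ^+ a.
  rewrite -powR_mulrn// ler_powR//; first by lra.
  exact/ltW/truncnS_gt.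
pose b l : R := M / Z ^+ l.
have bpos l : 0 < b l by rewrite divr_gt0// exprn_gt0.
have ZE l : 2 `^ (l%:R * (2^-1 + beta)) = Z ^+ l.
  by rewrite mulrC powRrM powR_mulrn// powR_ge0.
have v1' : 0 < 1 - v by lra.
have C0 : 0 <= 4 * M ^+ 2 / (1 - v) by rewrite divr_ge0 ?ltW// mulr_gt0 ?exprn_gt0.
exists (M ^+ 2 + 4 * M ^+ 2 / (1 - v)), a; split.
  by apply: ltr_pwDl; rewrite ?exprn_gt0.
move=> L delta f0 Hf0 delta0 small.
pose H := holder_density psi beta M.
have /choice[c hc] (f : R -> R) : exists c : nat -> nat -> R, H f ->
    L2_expansion psi c f /\
    forall l k, (k < 2 ^ l)%N -> `|c l k| <= b l.
  have [[_ _ _ [c [ec bc]]]|no] := pselect (H f); last by exists (fun _ _ => 0).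
  exists c => _; split => // l k kl; have := bc l k kl.
  by rewrite ZE /b ler_pdivlMr ?exprn_gt0// mulrC.
pose q f (p : nat * nat) := Num.trunc ((c f p.1 p.2 + b p.1) / b L).
have q_arg f p : H f -> (p.2 < 2 ^ p.1)%N ->
    0 <= (c f p.1 p.2 + b p.1) / b L <= 2 * b p.1 / b L.
  move=> /hc[_ /(_ p.1 p.2)] h /h; rewrite ler_norml => /andP[h1 h2].
  apply/andP; split; first by rewrite divr_ge0// ?(ltW (bpos L))//; lra.
  by rewrite ler_pM2r ?invr_gt0//; lra.
have q_lt f p : H f -> p \in wavelet_indices L ->
    (q f p < 2 ^ (a * (L - p.1) + 2))%N.
  move=> Hf; rewrite mem_wavelet_indices => /andP[pL p2].
  have /andP[h1 h2] := q_arg f p Hf p2.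
  rewrite /q truncn_lt_nat//; apply: le_lt_trans h2 _.
  have -> : 2 * b p.1 / b L = 2 * Z ^+ (L - p.1).
    rewrite /b -[in Z ^+ L](subnK (ltnW pL)) exprD.
    by field; rewrite !expf_neq0 ?lt0r_neq0.
  have : Z ^+ (L - p.1) <= (2 ^+ a) ^+ (L - p.1) by rewrite lerXn2r// nnegrE ltW.
  rewrite -exprM natrX exprD => h.
  have : 0 < (2 : R) ^+ (a * (L - p.1)) by rewrite exprn_gt0.
  by rewrite (_ : 2 ^+ 2 = 4 :> R); [lra | ring].
have [code [code_lt code_inj]] := mixed_radix q_lt.
have code_lt' f : H f -> (code f < 2 ^ ((2 * a + 2) * 2 ^ L))%N.
  move=> Hf; apply: leq_trans (code_lt f Hf) _.
  rewrite (big_wavelet_indices _ _ (fun l k => 2 ^ (a * (L - l) + 2))%N).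
  rewrite (eq_bigr (fun l => 2 ^ (2 ^ l * (a * (L - l) + 2)))%N); last first.
    by move=> l _; rewrite prod_nat_const_nat subn0 -expnM mulnC.
  by rewrite -expn_sum leq_exp2l// digit_budget.
have [g [gH gcov]] := code_representatives Hf0 code_lt'.
exists g; split => // f Hf; have [j cj] := gcov f Hf; exists j.
have dg := holder_unit_density (gH j); have df := holder_unit_density Hf.
apply: le_trans (TV_le_L1 dg df) _; rewrite lee_fin.
have [eg bg] := hc _ (gH j); have [ef bf] := hc _ Hf.
apply: (L1_le_coefficients onb dg df eg ef delta0) => n.
apply: le_trans small.
rewrite (big_wavelet_indices _ _ (fun l k => (c (g j) l k - c f l k) ^+ 2)).
have b2 l : 2 ^+ l * b l ^+ 2 = M ^+ 2 * v ^+ l.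
  rewrite /b vZ !expr_div_n -exprM mulnC exprM.
  by field; rewrite !expf_neq0 ?lt0r_neq0.
have level l (B : R) : (forall k, (k < 2 ^ l)%N -> `|c (g j) l k - c f l k| <= B) ->
    \sum_(0 <= k < 2 ^ l) (c (g j) l k - c f l k) ^+ 2 <= 2 ^+ l * B ^+ 2.
  move=> hB; apply: (@le_trans _ _ (\sum_(0 <= k < 2 ^ l) B ^+ 2)).
    rewrite big_nat [leRHS]big_nat; apply: ler_sum => k /andP[_ kl].
    rewrite -[leLHS]real_normK ?num_real// lerXn2r ?nnegrE//; last exact: hB.
    exact: le_trans (hB k kl).
  by rewrite sumr_const_nat subn0 -[leLHS]mulr_natl natrX.
apply: (le_trans (@two_regime_sum _ _ (b L ^+ 2) (4 * M ^+ 2) v L n _ _ _ _ _)).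
- by rewrite exprn_ge0// ltW.
- by rewrite mulr_ge0// exprn_ge0// ltW.
- by rewrite ltW.
- move=> l lL; apply: level => k kl.
  have lk : (l, k) \in wavelet_indices L by rewrite mem_wavelet_indices lL.
  have := code_inj _ _ (gH j) Hf cj (l, k) lk; rewrite /q /= => e.
  have /andP[g1 _] := q_arg _ (l, k) (gH j) kl.
  have /andP[f1 _] := q_arg _ (l, k) Hf kl.
  have /andP[g2 g3] := truncn_itv g1; have /andP[f2 f3] := truncn_itv f1.
  rewrite /= in g1 f1 g2 g3 f2 f3; rewrite e in g2 g3.
  (* both arguments of the truncation lie in the same unit interval *)
  rewrite -(ler_pM2r (_ : 0 < (b L)^-1)) ?invr_gt0// mulfV ?lt0r_neq0//.
  rewrite -[X in _ * X]gtr0_norm ?invr_gt0// -normrM ler_norml.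
  move: g2 g3 f2 f3; rewrite !mulrDl mulNr -natr1; set r := (_%:R : R).
  by move=> *; apply/andP; split; lra.
- move=> l _; apply: le_trans (level l (2 * b l) _) _.
    move=> k kl; apply: le_trans (ler_normB _ _) _.
    by have := bg l k kl; have := bf l k kl; lra.
  rewrite le_eqVlt; apply/orP; left; apply/eqP.
  by rewrite -mulrA -b2; ring.
- by rewrite b2 -mulrDl.
Qed.

(** * The tournament *)

(** A candidate within [4 * (t + a)] of the good candidate [j0] is also close
    to the sampling law, so a candidate far from [j0] loses to every one of
    them, [j0] included, whereas [j0] can only lose to candidates in that
    ball.  Hence a candidate far from [j0] has strictly more losses than
    [j0]. *)
Lemma tournament_winner_L1 (R : realType) (m n : nat) (g : 'I_m -> R -> R)
    (x : 'I_n -> R) (W : set R -> R) (t a : R) (j0 jhat : 'I_m) :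
  (forall j, unit_density (g j)) ->
  (forall j k, let A := [set y | 0 <= y <= 1 /\ g k y < g j y] in
     `|empirical x A - W A| <= t) ->
  (forall A, measurable A -> `|mass (g j0) A - W A| <= a) ->
  tournament_winner g x jhat ->
  L1 (g jhat) (g j0) <= 24 * (t + a).
Proof.
move=> dg emp close win; rewrite leNgt; apply/negP => far.
have t0 : 0 <= t by apply: le_trans (emp j0 j0).
have a0 : 0 <= a by apply: le_trans (close set0 measurable0).
pose A j k := [set y : R | 0 <= y <= 1 /\ g k y < g j y].
have mA j k : measurable (A j k) by exact: measurable_density_gt.
have gap j k : mass (g j) (A j k) - mass (g k) (A j k) = L1 (g j) (g k) / 2.
  exact: mass_density_gt.
have losesE j k : loses g x j k =
    (`|empirical x (A j k) - mass (g k) (A j k)| <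
     `|empirical x (A j k) - mass (g j) (A j k)|) by [].
have loses_near k : loses g x j0 k -> L1 (g j0) (g k) <= 4 * (t + a).
  rewrite losesE => h.
  have := emp j0 k; have := close _ (mA j0 k); have := gap j0 k; move: h.
  rewrite /= -/(A j0 k).
  move: (empirical _ _) (mass _ _) (mass _ _) (W _) => e p q w h.
  rewrite !ler_norml => eL /andP[h1 h2] /andP[h3 h4].
  have : `|e - p| <= t + a by rewrite ler_norml; apply/andP; split; lra.
  move=> /(lt_le_trans h); rewrite ltr_norml => /andP[h5 h6]; lra.
have far_loses k : L1 (g j0) (g k) <= 4 * (t + a) -> loses g x jhat k.
  move=> near; rewrite losesE.
  have tri := L1_triangle (dg jhat) (dg k) (dg j0).
  have := gap jhat k; have := emp jhat k; have := close _ (mA jhat k).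
  have := mass_dist_le_L1 (dg j0) (dg k) (mA jhat k).
  rewrite /= -/(A jhat k) [L1 (g k) _]L1C in tri *.
  move: (empirical _ _) (mass _ _) (mass _ _) (mass _ _) (W _) => e p pk p0 w.
  rewrite !ler_norml => /andP[h1 h2] /andP[h3 h4] /andP[h5 h6] eL.
  apply: (@le_lt_trans _ _ (5 * (t + a))).
    by rewrite ler_norml; apply/andP; split; lra.
  by apply: (@lt_le_trans _ _ (p - e)); [lra | rewrite distrC ler_norm].
have j0hat : j0 != jhat.
  by apply/eqP => e; move: far; rewrite e L1xx; lra.
have hat_beaten : loses g x jhat j0 by apply: far_loses; rewrite L1xx; lra.
have hat_not_near : ~~ loses g x j0 jhat.
  by apply/negP => /loses_near; rewrite L1C; lra.
have := win j0; apply/negP; rewrite -ltnNge.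
rewrite (bigD1 jhat) /= 1?eq_sym// (negbTE hat_not_near) add0n.
rewrite [ltnRHS](bigD1 j0) /=// hat_beaten add1n ltnS.
rewrite (eq_bigl (fun k => (k != jhat) && (k != j0))); last by move=> k; rewrite andbC.
apply: leq_sum => k _.
by case h: (loses g x j0 k) => //; rewrite far_loses// loses_near.
Qed.

(** * The contaminated law *)

Section contaminated_law.
Variables (R : realType) (f : R -> R) (Q : probability (measurableTypeR R) R).
Variable eps : R.
Hypotheses (df : unit_density f) (eps01 : 0 <= eps <= 1).

Definition contaminated_mass (A : set R) : R :=
  (1 - eps) * mass f A + eps * fine (Q A).

Let fine_probability (A : set R) : measurable A -> 0 <= fine (Q A) <= 1.
Proof.
move=> mA; have fQ : Q A \is a fin_num by exact: fin_num_measure.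
by rewrite fine_ge0//= -lee_fin fineK// probability_le1.
Qed.

Lemma contaminatedE A : measurable A ->
  contaminated eps f Q A = (contaminated_mass A)%:E.
Proof.
move=> mA; rewrite /contaminated /contaminated_mass density_probE// [RHS]EFinD !EFinM.
by rewrite (fineK (fin_num_measure Q A mA)).
Qed.

Lemma contaminated_mass_itv01 A : measurable A -> 0 <= contaminated_mass A <= 1.
Proof.
move=> mA; have /andP[f0 f1] := mass_itv01 df mA.
have /andP[q0 q1] := fine_probability mA; have /andP[e0 e1] := eps01.
rewrite /contaminated_mass; apply/andP; split.
  by rewrite addr_ge0// mulr_ge0//; lra.
have : (1 - eps) * mass f A <= (1 - eps) * 1 by rewrite ler_wpM2l//; lra.
have : eps * fine (Q A) <= eps * 1 by rewrite ler_wpM2l.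
lra.
Qed.

Lemma contaminated_mass_dist A : measurable A ->
  `|mass f A - contaminated_mass A| <= eps.
Proof.
move=> mA; have /andP[f0 f1] := mass_itv01 df mA.
have /andP[q0 q1] := fine_probability mA; have /andP[e0 e1] := eps01.
rewrite (_ : _ - _ = eps * (mass f A - fine (Q A))); last first.
  by rewrite /contaminated_mass; ring.
rewrite normrM ger0_norm// ler_piMr// ler_norml.
by apply/andP; split; lra.
Qed.

End contaminated_law.

(** Union bound over the comparison sets of all pairs of candidates, followed
    by the deterministic analysis of the tournament. *)
Lemma tournament_probability (R : realType) (f : R -> R)
    (Q : probability (measurableTypeR R) R) (eps delta t : R)
    (d : measure_display) (T : measurableType d) (P : probability T R)
    (n : nat) (X : 'I_n -> {RV P >-> R})
    (m : nat) (g : 'I_m -> R -> R) (jhat : T -> 'I_m) (bound : R) (j0 : 'I_m) :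
  (0 < n)%N -> 0 <= t -> 0 <= eps <= 1 ->
  unit_density f -> (forall j, unit_density (g j)) ->
  iid_sample X (contaminated eps f Q) ->
  (forall j, measurable (jhat @^-1` [set j])) ->
  (forall w, tournament_winner g (fun i => X i w) (jhat w)) ->
  (TV (density_prob (g j0)) (density_prob f) <= delta%:E)%E ->
  (24 * (t + (delta + eps)) + 2 * delta) ^+ 2 <= bound ->
  (P [set w | L1_dist (g (jhat w)) f ^+ 2 <= bound%:E] >=
     1 - (m%:R ^+ 2 * (2 * expR (- (n%:R * t ^+ 2 / 8))))%R%:E)%E.
Proof.
move=> n0 t0 eps01 df dg iidX mjhat win cov hbound.
pose A (p : 'I_m * 'I_m) := [set y : R | 0 <= y <= 1 /\ g p.2 y < g p.1 y].
have mA p : measurable (A p) by exact: measurable_density_gt.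
pose W := contaminated_mass f Q eps.
pose bad p := [set w | t <= `|empirical (fun i => X i w) (A p) - W (A p)|].
pose E := [set w | (L1_dist (g (jhat w)) f ^+ 2 <= bound%:E)%E].
have mE : measurable E.
  rewrite (_ : E = \big[setU/set0]_(j | (L1_dist (g j) f ^+ 2 <= bound%:E)%E)
      (jhat @^-1` [set j])); last first.
    rewrite -(bigcup_pred [pred j : 'I_m | (L1_dist (g j) f ^+ 2 <= bound%:E)%E]).
    apply/seteqP; split => [w Ew|w [j /= hj jw]]; first by exists (jhat w).
    by rewrite /E /= jw.
  by apply: bigsetU_measurable.
have mbad p : measurable (bad p).
  exact: (measurable_empirical X [set v | t <= `|v - W (A p)|] (mA p)).
have sub : ~` E `<=` \big[setU/set0]_(p : 'I_m * 'I_m) bad p.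
  rewrite -(bigcup_pred predT) => w nE; apply: contrapT => good; apply: nE.
  have emp j k : `|empirical (fun i => X i w) (A (j, k)) - W (A (j, k))| <= t.
    rewrite leNgt; apply/negP => h; apply: good; exists (j, k) => //.
    exact: ltW.
  have close B : measurable B -> `|mass (g j0) B - W B| <= delta + eps.
    move=> mB; apply: le_trans (ler_distD (mass f B) _ _) _; apply: lerD.
      exact: mass_dist_le_TV.
    exact: contaminated_mass_dist.
  have hat := tournament_winner_L1 dg emp close (win w).
  have cov1 := L1_le_TV (dg j0) df cov.
  have tri := L1_triangle (dg (jhat w)) (dg j0) df.
  rewrite /E /= L1_distE// -EFinM -expr2 lee_fin; apply: le_trans hbound.
  by rewrite lerXn2r ?nnegrE ?L1_ge0//; have := L1_ge0 (g j0) f; lra.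
have -> : P E = (1 - P (~` E))%E.
  by rewrite -probability_setC ?setCK//; exact: measurableC.
apply: leeB => //.
apply: (@le_trans _ _ (P (\big[setU/set0]_(p : 'I_m * 'I_m) bad p))).
  apply: le_measure => //; rewrite inE; first exact: measurableC.
  exact: bigsetU_measurable.
apply: le_trans (probability_bigsetU_le _ _ _ mbad) _.
apply: (@le_trans _ _ (\sum_(p : 'I_m * 'I_m)
    (2 * expR (- (n%:R * t ^+ 2 / 8)))%:E)%E).
  apply: lee_sum => p _; apply: (empirical_deviation iidX) => //.
    exact: contaminatedE.
  exact: contaminated_mass_itv01.
rewrite sumEFin lee_fin sumr_const card_prod card_ord -[leLHS]mulr_natl.
by rewrite natrM expr2.
Qed.

(** * Calibration of the rates *)

Lemma dyadic_between (R : realType) (y : R) : 1 <= y ->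
  exists L : nat, y <= 2 ^+ L /\ 2 ^+ L <= 2 * y.
Proof.
move=> y1; have k0 : (0 < Num.trunc y)%N by rewrite truncn_gt0.
have y0 : 0 <= y by lra.
exists (trunc_log 2 (Num.trunc y)).+1; split.
  apply: (le_trans (ltW (truncnS_gt y))).
  by rewrite -natrX ler_nat trunc_log_ltn.
rewrite exprS ler_pM2l// -natrX.
apply: (@le_trans _ _ (Num.trunc y)%:R).
  by rewrite ler_nat trunc_logP.
by rewrite truncn_le.
Qed.

Lemma sqr_add_le_max (R : realType) (x y : R) : 0 <= x -> 0 <= y ->
  (x + y) ^+ 2 <= 4 * Num.max (x ^+ 2) (y ^+ 2).
Proof.
move=> x0 y0.
have hx : x ^+ 2 <= Num.max (x ^+ 2) (y ^+ 2) by rewrite le_max lexx.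
have hy : y ^+ 2 <= Num.max (x ^+ 2) (y ^+ 2) by rewrite le_max lexx orbT.
have := sqr_ge0 (x - y); rewrite sqrrB sqrrD; lra.
Qed.

(** * The risk bound *)

Theorem corollary4p1 (R : realType) (psi : nat -> nat -> R -> R)
    (Hpsi : cdv_basis psi) (beta M c1 c2 : R)
    (Hbeta : 0 < beta) (HM : 0 < M) (Hc1 : 0 < c1) (Hc12 : c1 <= c2) :
  exists C C' : R, [/\ 0 < C, 0 < C' &
    forall (n : nat) (delta eps : R),
      (0 < n)%N ->
      c1 * n%:R `^ (- (beta / (2 * beta + 1))) <= delta ->
      delta <= c2 * n%:R `^ (- (beta / (2 * beta + 1))) ->
      0 <= eps <= 1 ->
    forall (f : R -> R) (Q : probability (measurableTypeR R) R),
      holder_density psi beta M f ->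
    forall (d : measure_display) (T : measurableType d) (P : probability T R)
      (X : 'I_n -> {RV P >-> R}) (fhat : T -> R -> R),
      iid_sample X (contaminated eps f Q) ->
      tournament_estimator (holder_density psi beta M) delta X fhat ->
      (P [set w | L1_dist (fhat w) f ^+ 2 <=
            (C * Num.max (n%:R `^ (- (2 * beta / (2 * beta + 1))))
                         (eps ^+ 2))%:E]
       >= (1 - expR (- (C' * (n%:R `^ (1 / (2 * beta + 1))
                              + n%:R * eps ^+ 2))))%:E)%E].
Proof.
have [onb _] := Hpsi.
have [K [a [K0 cover]]] := holder_covering onb Hbeta HM.
have c12 : 0 < c1 ^+ 2 by rewrite exprn_gt0.
have D0 : 0 < 2 * beta + 1 by lra.
have b20 : 0 < 2 * beta by lra.
(* [A0] makes the level-[L] approximation error at most [c1 * r] *)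
pose A0 : R := 1 + (K / c1 ^+ 2) `^ (2 * beta)^-1.
have A0_ge1 : 1 <= A0 by rewrite lerDl powR_ge0.
have A0K : K <= c1 ^+ 2 * A0 `^ (2 * beta).
  rewrite -ler_pdivrMl// mulrC.
  have q0 : 0 <= K / c1 ^+ 2 by rewrite divr_ge0// ltW.
  apply: (@le_trans _ _ (((K / c1 ^+ 2) `^ (2 * beta)^-1) `^ (2 * beta))).
    by rewrite -powRrM mulVf ?lt0r_neq0// powRr1.
  by rewrite ge0_ler_powR ?nnegrE ?powR_ge0 ?lerDr//; lra.
(* [expR (kappa * N)] dominates twice the squared number of candidates *)
pose kappa : R := 1 + 2 * (2 * a + 2)%:R * (2 * A0).
have kappa0 : 0 <= kappa by rewrite addr_ge0// !mulr_ge0//; lra.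
pose s : R := Num.sqrt (8 * (kappa + 1)).
have s0 : 0 <= s by exact: sqrtr_ge0.
have s2 : s ^+ 2 = 8 * (kappa + 1) by rewrite sqr_sqrtr//; lra.
pose B : R := 24 * s + 24 + 26 * c2.
have B0 : 0 < B by rewrite /B; lra.
exists (4 * B ^+ 2), 1; split => //; first by rewrite mulr_gt0// exprn_gt0.
move=> n delta eps n0 delta1 delta2 eps01 f Q Hf d T P X fhat iidX.
move=> [m [g [jhat [[[gH gcov] gmin] mjhat win fhatE]]]].
have nR : 0 < n%:R :> R by rewrite ltr0n.
have n1 : 1 <= n%:R :> R by rewrite ler1n.
have /andP[e0 e1] := eps01.
set N : R := n%:R `^ (1 / (2 * beta + 1)).
pose r : R := n%:R `^ (- (beta / (2 * beta + 1))).
rewrite -/r in delta1 delta2.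
have N1 : 1 <= N.
  rewrite -(powRr0 n%:R) ler_powR//; last by rewrite divr_ge0//; lra.
have r0 : 0 < r by exact: powR_gt0.
have r2 : r ^+ 2 = n%:R `^ (- (2 * beta / (2 * beta + 1))).
  by rewrite -powR_mulrn ?ltW// -powRrM; congr (_ `^ _); ring.
have rN : r ^+ 2 = N `^ (- (2 * beta)).
  by rewrite r2 -powRrM; congr (_ `^ _); ring.
have nr2 : n%:R * r ^+ 2 = N.
  rewrite r2 -[X in X * _]powRr1 ?ltW// -powRD; last by rewrite lt0r_neq0// implybT.
  by congr (_ `^ _); field; lra.
have delta0 : 0 < delta by apply: lt_le_trans delta1; rewrite mulr_gt0.
have [L [L1 L2]] : exists L : nat, A0 * N <= 2 ^+ L /\ 2 ^+ L <= 2 * (A0 * N).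
  by apply: dyadic_between; rewrite -[leLHS]mulr1 ler_pM.
have small : K * (2 `^ (- (2 * beta))) ^+ L <= delta ^+ 2.
  have AN : 0 < A0 * N by rewrite mulr_gt0//; lra.
  have pow_swap w : (2 `^ (- w)) ^+ L = ((2 ^+ L) `^ w)^-1 :> R.
    rewrite -powR_mulrn ?powR_ge0// -powRrM mulrC powRrM powR_mulrn//.
    by rewrite powRN.
  rewrite pow_swap.
  apply: (@le_trans _ _ (K * ((A0 * N) `^ (2 * beta))^-1)).
    rewrite ler_pM2l// lef_pV2 ?posrE ?powR_gt0 ?exprn_gt0//.
    by rewrite ge0_ler_powR ?nnegrE ?exprn_ge0//; lra.
  apply: (@le_trans _ _ ((c1 * r) ^+ 2)); last first.
    by rewrite lerXn2r ?nnegrE ?mulr_ge0//; lra.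
  rewrite powRM ?invfM; [|lra|lra].
  rewrite exprMn rN powRN mulrA ler_pM2r ?invr_gt0 ?powR_gt0//.
  by rewrite ler_pdivrMr// powR_gt0//; lra.
have [g' cov'] := cover L delta f Hf delta0 small.
have mle := gmin _ _ cov'.
have [j0 cov0] := gcov f Hf.
have df := holder_unit_density Hf.
have dg j := holder_unit_density (gH j).
pose t := s * (r + eps).
have t0 : 0 <= t by rewrite mulr_ge0//; lra.
pose bound := 4 * B ^+ 2 * Num.max (r ^+ 2) (eps ^+ 2).
have hbound : (24 * (t + (delta + eps)) + 2 * delta) ^+ 2 <= bound.
  apply: (@le_trans _ _ ((B * (r + eps)) ^+ 2)).
    rewrite lerXn2r ?nnegrE//; first lra.
      by rewrite mulr_ge0//; lra.
    have : 0 <= c2 * eps by rewrite mulr_ge0//; lra.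
    by rewrite /B /t; lra.
  rewrite /bound [4 * B ^+ 2]mulrC -mulrA exprMn ler_pM2l ?exprn_gt0//.
  by apply: sqr_add_le_max => //; lra.
have := tournament_probability n0 t0 eps01 df dg iidX mjhat win cov0 hbound.
rewrite -r2 -/bound.
rewrite (_ : [set w | _] = [set w | (L1_dist (fhat w) f ^+ 2 <= bound%:E)%E]); last first.
  by apply/seteqP; split => w /=; rewrite fhatE.
apply: le_trans; rewrite mul1r EFinB leeB// lee_fin.
have count : m%:R ^+ 2 * 2 <= expR (kappa * N).
  have two : (2 : R) <= expR 1 by apply: le_trans (expR_ge1Dx _); rewrite -natr1 addrC.
  have mR : m%:R <= expR ((2 * a + 2)%:R * (2 * (A0 * N))) :> R.
    apply: (@le_trans _ _ ((2 ^ ((2 * a + 2) * 2 ^ L))%:R)); first by rewrite ler_nat.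
    rewrite natrX; apply: (@le_trans _ _ (expR 1 ^+ ((2 * a + 2) * 2 ^ L))).
      by rewrite lerXn2r ?nnegrE ?expR_ge0.
    rewrite -expRM_natl mulr1 ler_expR natrM natrX.
    by rewrite ler_wpM2l.
  have -> : kappa * N = (2%:R * ((2 * a + 2)%:R * (2 * (A0 * N)))) + N.
    by rewrite /kappa; ring.
  rewrite expRD expRM_natl ler_pM// ?exprn_ge0//.
    by rewrite lerXn2r ?nnegrE ?expR_ge0.
  by apply: (le_trans two); rewrite ler_expR.
rewrite mulrA; apply: (@le_trans _ _ (expR (kappa * N) * expR (- (n%:R * t ^+ 2 / 8)))).
  by rewrite ler_wpM2r// expR_ge0.
rewrite -expRD ler_expR.
have nt2 : 8 * (kappa + 1) * (N + n%:R * eps ^+ 2) <= n%:R * t ^+ 2.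
  rewrite /t exprMn s2 [leRHS]mulrCA ler_wpM2l//; first lra.
  rewrite -nr2 -mulrDr ler_pM2l// sqrrD.
  have : 0 <= r * eps by rewrite mulr_ge0//; lra.
  lra.
have ne0 : 0 <= n%:R * eps ^+ 2 by rewrite mulr_ge0 ?sqr_ge0//; lra.
have : 0 <= kappa * (n%:R * eps ^+ 2) by rewrite mulr_ge0.
lra.
Qed.
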